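(* Let $(X,d)$ be a compact metric space and let $(X,\mathbb{F})$ be a minimal non-autonomous dynamical system generated by a commutative family $\mathbb{F}=\{f_n:n\in\mathbb{N}\}$ of homeomorphisms of $X$. Then either $(X,\mathbb{F})$ is equicontinuous, or the set of points $x\in X$ at which $(X,\mathbb{F})$ is sensitive is dense in $X$.
   Context: $\mathbb{N}=\{1,2,3,\dots\}$. The family $\mathbb{F}$ is commutative if $f_n\circ f_m=f_m\circ f_n$ for all $n,m$. The non-autonomous system $(X,\mathbb{F})$ has time-$n$ states $\omega_n(x)$, $n\in\mathbb{Z}$, defined by $\omega_0(x)=x$, $\omega_n(x)=f_n(\omega_{n-1}(x))$ for $n\ge 1$, and $\omega_n(x)=f_{-n}^{-1}(\omega_{n+1}(x))$ for $n<0$; thus $\omega_n=f_n\circ\cdots\circ f_1$ and $\omega_{-n}=f_n^{-1}\circ\cdots\circ f_1^{-1}$ for $n\geq 1$. A set $Y\subseteq X$ is invariant if $\omega_k(Y)\subseteq Y$ for all $k\in\mathbb{Z}$. $(X,\mathbb{F})$ is minimal if $X$ is non-empty and no proper non-empty subset of $X$ is closed and invariant. $(X,\mathbb{F})$ is equicontinuous if for each $\epsilon>0$ there exists $\delta>0$ such that for all $x,y\in X$, $d(x,y)<\delta$ implies $d(\omega_n(x),\omega_n(y))<\epsilon$ for all $n\in\mathbb{Z}$. $(X,\mathbb{F})$ is sensitive at a point $x$ if there exists $\delta_x>0$ such that for each neighborhood $U_x$ of $x$ there exists $k\in\mathbb{Z}$ with $\operatorname{diam}(\omega_k(U_x))>\delta_x$.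 *)

(* Defs.v *)
From HB Require Import structures.
From mathcomp Require Export all_boot all_order all_algebra.
From mathcomp Require Export all_classical all_reals all_analysis.

Set Implicit Arguments.
Unset Strict Implicit.
Unset Printing Implicit Defensive.

Local Open Scope classical_set_scope.
Local Open Scope ring_scope.

(* The inverse is carried as data; it is determined by the underlying map. *)
Record homeo (T : topologicalType) := Homeo {
  homeo_fun :> T -> T;
  homeo_inv : T -> T;
  homeo_funK : cancel homeo_fun homeo_inv;
  homeo_invK : cancel homeo_inv homeo_fun;
  homeo_fun_continuous : continuous homeo_fun;
  homeo_inv_continuous : continuous homeo_inv
}.

(* A family f_1, f_2, ... of homeomorphisms is a function F on nat, with F n
   standing for f_(n+1). *)

Definition commutative_family (T : topologicalType) (F : nat -> homeo T) :=
  forall n m : nat, F n \o F m =1 F m \o F n.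

Fixpoint state_fwd (T : topologicalType) (F : nat -> homeo T) (n : nat)
    (x : T) : T :=
  if n is n'.+1 then F n' (state_fwd F n' x) else x.

Fixpoint state_bwd (T : topologicalType) (F : nat -> homeo T) (n : nat)
    (x : T) : T :=
  if n is n'.+1 then homeo_inv (F n') (state_bwd F n' x) else x.

(* The time-k state omega_k(x); recall that Negz n is -(n+1). *)
Definition state (T : topologicalType) (F : nat -> homeo T) (k : int)
    (x : T) : T :=
  match k with
  | Posz n => state_fwd F n x
  | Negz n => state_bwd F n.+1 x
  end.

Definition invariant_set (T : topologicalType) (F : nat -> homeo T)
    (Y : set T) :=
  forall k : int, state F k @` Y `<=` Y.

Definition minimal_system (T : topologicalType) (F : nat -> homeo T) :=
  [set: T] !=set0 /\
  ~ exists Y : set T,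
      [/\ Y `<` [set: T], Y !=set0, closed Y & invariant_set F Y].

(* Unlike the library's equicontinuous, which is pointwise, this is uniform
   over the space. *)
Definition equicontinuous_system (R : realType) (X : metricType R)
    (F : nat -> homeo X) :=
  forall e : R, 0 < e -> exists2 d : R, 0 < d &
    forall x y : X, mdist x y < d ->
      forall k : int, mdist (state F k x) (state F k y) < e.

(* Extended-real valued; the diameter of the empty set is -oo. *)
Definition diam (R : realType) (X : metricType R) (A : set X) : \bar R :=
  ereal_sup [set (mdist z.1 z.2)%:E | z in A `*` A].

Definition sensitive_at (R : realType) (X : metricType R)
    (F : nat -> homeo X) (x : X) :=
  exists2 d : R, 0 < d &
    forall U : set X, nbhs x U ->
      exists k : int, (d%:E < diam (state F k @` U))%E.

(* Main.v *)
Require Import Defs.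

(** Let [S] be the set of sensitivity points. If [omega_j x] is not a
    sensitivity point then neither is [x], because
    [omega_k = omega_(-j) o omega_k o omega_j] by commutativity and
    [omega_(-j)] is uniformly continuous. Hence [S] is invariant, and so is its
    closure, which by minimality is empty or [X]. If it is empty, every point
    has neighborhoods with uniformly small images under all [omega_k], and
    compactness makes this uniform in the point. *)

Set Implicit Arguments.
Unset Strict Implicit.
Unset Printing Implicit Defensive.

Import Order.TTheory GRing.Theory Num.Theory.

Local Open Scope classical_set_scope.
Local Open Scope ring_scope.

Section States.
Variables (T : topologicalType) (F : nat -> homeo T).

Lemma homeo_inv_comm (f : homeo T) (h : T -> T) :
  (forall x, h (f x) = f (h x)) ->
  forall x, h (homeo_inv f x) = homeo_inv f (h x).
Proof.
move=> hf x; apply: (can_inj (homeo_funK f)).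
by rewrite -hf !homeo_invK.
Qed.

(** Used twice to lift commutativity from the generators to all states: first with [h] some [F n],
    then with [h] itself a state map. *)
Lemma state_comm_map (h : T -> T) :
  (forall n x, h (F n x) = F n (h x)) ->
  forall k x, h (state F k x) = state F k (h x).
Proof.
move=> hF [] n x; rewrite /state.
  by elim: n => //= n IH; rewrite hF IH.
elim: n.+1 => //= {}n IH.
by rewrite (homeo_inv_comm (hF n)) IH.
Qed.

Lemma state_continuous k : continuous (state F k).
Proof.
case: k => n; rewrite /state.
  elim: n => [|n IH] x; first exact: cvg_id.
  exact: continuous_comp (IH x) (@homeo_fun_continuous _ _ _).
elim: n.+1 => [|{}n IH] x; first exact: cvg_id.
exact: continuous_comp (IH x) (@homeo_inv_continuous _ _ _).
Qed.

Hypothesis hcomm : commutative_family F.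

Lemma state_map_comm k n x : state F k (F n x) = F n (state F k x).
Proof. by rewrite -state_comm_map // => m y; apply: hcomm. Qed.

Lemma state_state_comm j k x :
  state F j (state F k x) = state F k (state F j x).
Proof. by apply: state_comm_map => n y; apply: state_map_comm. Qed.

(** [state_bwd] composes the inverses in the same order as [state_fwd] composes the maps, not in
    reverse, so cancellation rests on commutativity: [F n] is first carried out past [state_bwd F n]
    to meet its inverse. *)
Lemma state_bwdK n : cancel (state_fwd F n) (state_bwd F n).
Proof.
elim: n => //= n IH x.
have -> : state_bwd F n (F n (state_fwd F n x)) =
          F n (state_bwd F n (state_fwd F n x)).
  case: n {IH} => // n; exact: (state_map_comm (Negz n)).
by rewrite IH homeo_funK.
Qed.

Lemma state_fwdK n : cancel (state_bwd F n) (state_fwd F n).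
Proof.
move=> x; rewrite -[RHS](state_bwdK n); case: n => // n.
exact: (state_state_comm n.+1 (Negz n)).
Qed.

Lemma state_oppK k : cancel (state F k) (state F (- k)).
Proof.
case: k => n; last exact: (@state_fwdK n.+1).
by case: n => // n; apply: (@state_bwdK n.+1).
Qed.

End States.

Section Sensitivity.
Variables (R : realType) (X : metricType R).

(** A Lebesgue number argument. The index type is arbitrary so that it serves both a single
    continuous map and the family of all states. *)
Lemma compact_equicontinuous (I : Type) (g : I -> X -> X) :
  compact [set: X] ->
  (forall (x : X) (e : R), 0 < e -> exists2 U : set X, nbhs x U &
     forall a b, U a -> U b -> forall k, mdist (g k a) (g k b) <= e) ->
  forall e : R, 0 < e -> exists2 d : R, 0 < d &
    forall x y, mdist x y < d -> forall k, mdist (g k x) (g k y) < e.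
Proof.
move=> /compact_near_coveringP cX gE e e0.
(* Near-covering form of compactness with the radius [d] as filter parameter: local choices of [d]
   yield a single one for all points. *)
have /cX : forall x : X, [set: X] x -> \forall x' \near x & d \near 0^'+,
    forall y, mdist x' y < d -> forall k, mdist (g k x') (g k y) < e.
  move=> x _; have [|U /nbhs_ballP[r /= r0 rU] Ue] := gE x (e / 2).
    by rewrite divr_gt0.
  (* With these halves, both [x'] and [y] fall in the ball of radius [r] around [x], hence in
     [U]. *)
  exists (ball x (r / 2), [set d | d < r / 2]) => /=.
    split; first by apply: nbhsx_ballx; rewrite divr_gt0.
    by apply: nbhs_right_lt; rewrite divr_gt0.
  move=> [x' d] /= [xx' dr] y x'y k.
  apply: le_lt_trans (_ : e / 2 < e); last first.
    by rewrite ltr_pdivrMr // ltr_pMr // ltr1n.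
  apply: Ue; apply: rU.
    by apply: le_ball xx'; rewrite ler_pdivrMr // ler_peMr ?ler1n // ltW.
  rewrite (splitr r); apply: ball_triangle xx' _.
  by rewrite ballEmdist /=; apply: lt_trans dr.
move=> H.
have [d [d0 Hd]] : exists d : R, 0 < d /\
    [set: X] `<=` [set x | forall y, mdist x y < d ->
      forall k, mdist (g k x) (g k y) < e].
  near (0 : R)^'+ => d; exists d; split; first by [].
  by near: d.
by exists d => // x y; apply: Hd.
Unshelve. all: by end_near. Qed.

Lemma compact_unif_continuous (h : X -> X) :
  compact [set: X] -> continuous h ->
  forall e : R, 0 < e -> exists2 d : R, 0 < d &
    forall x y, mdist x y < d -> mdist (h x) (h y) < e.
Proof.
move=> cX ch e e0.
have [|//|d d0 dP] := @compact_equicontinuous unit (fun=> h) cX _ e.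
  move=> x r r0; exists (h @^-1` ball (h x) (r / 2)).
    by apply: ch; apply: nbhsx_ballx; rewrite divr_gt0.
  move=> a b ha hb _; apply: ltW.
  have := ball_splitr ha hb.
  by rewrite ballEmdist.
by exists d => // x y /dP; apply.
Qed.

Variable F : nat -> homeo X.

(** The diameter is a supremum, so negating the strict inequality leaves a non-strict bound on
    pairs, as in the local hypothesis of [compact_equicontinuous]. *)
Lemma not_sensitive_atP x : ~ sensitive_at F x <->
  forall e : R, 0 < e -> exists2 U : set X, nbhs x U &
    forall a b, U a -> U b -> forall k, mdist (state F k a) (state F k b) <= e.
Proof.
split=> [nS e e0|xE [e e0 S]].
  apply: contrapT => nU; apply: nS; exists e => // U xU.
  apply: contrapT => nk; apply: nU; exists U => // a b Ua Ub k.
  rewrite leNgt; apply/negP => ltab; apply: nk; exists k.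
  apply: (@lt_le_trans _ _ (mdist (state F k a) (state F k b))%:E).
    by rewrite lte_fin.
  apply: ereal_sup_ubound; exists (state F k a, state F k b) => //.
  by split; [exists a | exists b].
have [U /S[k]] := xE e e0.
rewrite ltNge => /negP dU Ue; apply: dU.
apply: ge_ereal_sup => _ [[_ _] [[a Ua <-] [b Ub <-]] <-].
by rewrite lee_fin Ue.
Qed.

Hypotheses (hX : compact [set: X]) (hcomm : commutative_family F).

Lemma sensitive_at_state j x : sensitive_at F x -> sensitive_at F (state F j x).
Proof.
move=> Sx; apply: contrapT => /not_sensitive_atP nS; move: Sx.
apply/not_sensitive_atP => e e0.
have [d d0 dP] :=
  compact_unif_continuous hX (@state_continuous _ F (- j)) e0.
(* [Ud] gives only a non-strict bound; halving makes it strictly less than [d]. *)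
have [|U xU Ud] := nS (d / 2); first by rewrite divr_gt0.
exists (state F j @^-1` U); first exact: state_continuous.
move=> a b Ua Ub k; apply: ltW.
rewrite -(state_oppK hcomm j (state F k a)) -(state_oppK hcomm j (state F k b)).
apply: dP; rewrite !(state_state_comm hcomm j k).
apply: le_lt_trans (Ud _ _ Ua Ub k) _.
by rewrite ltr_pdivrMr // ltr_pMr // ltr1n.
Qed.

Lemma closure_invariant (S : set X) :
  invariant_set F S -> invariant_set F (closure S).
Proof.
move=> SF k _ [x Sx <-] U /(@state_continuous _ F k)/Sx[y [Sy Uy]].
by exists (state F k y); split => //; apply: (SF k); exists y.
Qed.

End Sensitivity.

Theorem proposition13 (R : realType) (X : metricType R) (F : nat -> homeo X)
    (hX : compact [set: X]) (hcomm : commutative_family F)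
    (hmin : minimal_system F) :
  equicontinuous_system F \/ dense [set x : X | sensitive_at F x].
Proof.
set S := [set x | _].
have [S0|/set0P[s Ss]] := eqVneq S set0.
  left; apply: compact_equicontinuous hX _ => x; apply/not_sensitive_atP => Sx.
  by have : S x by []; rewrite S0.
right.
have clS x : closure S x.
  (* A point [x] outside the closure makes it a proper subset, against minimality. *)
  apply: contrapT => nx; case: hmin => _; apply; exists (closure S); split.
  - by split=> // /(_ x I).
  - by exists s; apply: subset_closure.
  - exact: closed_closure.
  - apply: closure_invariant => k _ [y Sy <-].
    exact: sensitive_at_state.
move=> O [x Ox] oO; rewrite setIC.
by apply: (clS x); apply: open_nbhs_nbhs.
Qed.
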